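(* Let $(\nabla,s)$ and $(\nabla,t)$ be NLA-terms-in-context and $X$ a term-variable not occurring in $\nabla,s,t$. If there is a derivation $\{X:t\triangleq s\};\emptyset;\emptyset;\mathit{Id}\Rightarrow^{+}\emptyset;S;\Gamma;\sigma$ of $\mathrm{NAU}_E$, then $(\Gamma,X\sigma)$ is an $E$-generalization of $(\nabla,t)$ and $(\nabla,s)$.
   Context: Ground language. Fix a countably infinite set $\mathbb{A}$ of atoms and a signature $\Sigma=\Sigma_\emptyset\sqcup\Sigma_{A}\sqcup\Sigma_{C}\sqcup\Sigma_{AC}$ of function symbols with arities, where the symbols of $\Sigma_A,\Sigma_C,\Sigma_{AC}$ are binary. Ground terms: $S::=a\mid f(S_1,\dots,S_n)\mid\lambda a.S$. Ground permutations are finite-support bijections of $\mathbb{A}$, acting by $\pi\cdot a=\pi(a)$, $\pi\cdot f(S_1,\dots,S_n)=f(\pi\cdot S_1,\dots,\pi\cdot S_n)$, $\pi\cdot\lambda a.S=\lambda\pi(a).\pi\cdot S$. Freshness $a\#S$ means $a$ does not occur free in $S$. $\approx_E$ is the least congruence on ground terms containing $\alpha$-equivalence ($\lambda a.S\approx\lambda b.T$ if $S\approx(a\,b)\cdot T$ and $a\#T$), commutativity $f(S_1,S_2)=f(S_2,S_1)$ for $f\in\Sigma_C\cup\Sigma_{AC}$ and associativity $f(f(S_1,S_2),S_3)=f(S_1,f(S_2,S_3))$ for $f\in\Sigma_A\cup\Sigma_{AC}$; $[S]_E$ is the $\approx_E$-class. Associative/AC applications are written flattened $f(t_1,\dots,t_n)$,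 $n\ge2$, with $f(t)$ standing for $t$. $E$ is one of: no equational symbols, or only associative, only commutative, or only AC symbols besides free ones. NLA-language. Disjoint countably infinite sets of term-variables $X,Y,Z,\dots$ and atom-variables $A,B,C,\dots$. NLA-terms: $s::=W\mid\pi\cdot X\mid f(s_1,\dots,s_n)\mid\lambda W.s$, $W::=\pi\cdot A$, $\pi::=\mathit{id}\mid(W_1\,W_2)\circ\pi$. Substitutions map term-variables to NLA-terms and atom-variables to atom suspensions (postfix notation). An interpretation $\rho$ maps atom-variables to atoms (not necessarily injectively) and term-variables to ground terms, extended homomorphically ($(W_1\,W_2)\circ\pi$ becomes the swapping $(W_1\rho\;W_2\rho)$ composed with $\pi\rho$). Freshness constraints $W\#s$; a freshness context is a finite set of them; $\Gamma\rho$ holds if all $W\rho\#s\rho$ hold. $\Gamma\models s\approx_E t$ (resp. $\Gamma\models\pi_1\cdot A=\pi_2\cdot B$) means: for every $\rho$ with $\Gamma\rho$ holding, $s\rho\approx_E t\rho$ (resp. the atoms coincide). A term-in-context is a pair $(\nabla,s)$; its semantics is $[\![\nabla,s]\!]=\{[s\rho]_E\mid\rho\text{ an interpretation with }\nabla\rho\text{ holding}\}$. $(\nabla,r)$ is an $E$-generalization of $(\nabla_1,s)$ and $(\nabla_2,t)$ iff $[\![\nabla_1,s]\!]\subseteq[\![\nabla,r]\!]$ and $[\![\nabla_2,t]\!]\subseteq[\![\nabla,r]\!]$. The system $\mathrm{NAU}_E$ works on states $P;S;\Gamma;\sigma$ ($P$ a set of equations $X:t\triangleq s$ with $X$ a term-variable;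 $S$ a store of such equations or of $C:\pi_1\cdot A\triangleq\pi_2\cdot B$ with $C$ an atom-variable; $\Gamma$ a freshness context; $\sigma$ a substitution). ''Fresh''/''new'' variables occur nowhere else. Rules (nondeterministic): Dec: $\{X:f(t_1..t_m)\triangleq f(s_1..s_m)\}\dot\cup P;S;\Gamma;\sigma\Rightarrow\{Y_i:t_i\triangleq s_i\}_i\cup P;S;\Gamma;\sigma\{X\mapsto f(Y_1..Y_m)\}$, $Y_i$ fresh. Abs: $\{X:\lambda W_1.t\triangleq\lambda W_2.s\}\dot\cup P;S;\Gamma;\sigma\Rightarrow\{Y:(W_1\,C)\cdot t\triangleq(W_2\,C)\cdot s\}\cup P;S;\Gamma\cup\{C\#\lambda W_1.t,C\#\lambda W_2.s\};\sigma\{X\mapsto\lambda C.Y\}$, $Y$ fresh, $C$ a new atom-variable. SusAA: remove $X:\pi_1\cdot A\triangleq\pi_2\cdot B$, extend $\sigma$ by $X\mapsto\pi_1\cdot A$, if $\Gamma\models\pi_1\cdot A=\pi_2\cdot B$. SusYY: remove $X:\pi_1\cdot Y\triangleq\pi_2\cdot Y$, extend $\sigma$ by $X\mapsto\pi_1\cdot Y$, if $\Gamma\models\pi_1\cdot Y\approx_E\pi_2\cdot Y$. SolAB: if $\Gamma\not\models\pi_1\cdot A=\pi_2\cdot B$: remove $X:\pi_1\cdot A\triangleq\pi_2\cdot B$ from $P$, add $C:\pi_1\cdot A\triangleq\pi_2\cdot B$ to $S$, add $C\#\lambda\pi_1\cdot A.\lambda\pi_2\cdot B.C$ to $\Gamma$,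 extend $\sigma$ by $X\mapsto C$ ($C$ new). Sol: move $X:t\triangleq s$ from $P$ to $S$ when none of Dec, Abs, SusAA, SusYY, SolAB applies. Mer: $\emptyset;\{Z_1:t_1\triangleq s_1,Z_2:t_2\triangleq s_2\}\dot\cup S;\Gamma;\sigma\Rightarrow\emptyset;\{Z_1:t_1\triangleq s_1\}\cup S;\Gamma\{Z_2\mapsto\pi\cdot Z_1\};\sigma\{Z_2\mapsto\pi\cdot Z_1\}$, $Z_1,Z_2$ both atom- or both term-variables, $\pi$ an atom-variable permutation computed by an equivariance procedure on $t_1\rhd t_2$, $s_1\rhd s_2$ under $\Gamma$, satisfying $\Gamma\models\pi\cdot t_1\approx_E t_2$ and $\Gamma\models\pi\cdot s_1\approx_E s_2$. DecA ($f$ associative, $n,m\ge2$, any $1\le k<n,1\le l<m$): replace $X:f(t_1..t_n)\triangleq f(s_1..s_m)$ by $Y_1:f(t_1..t_k)\triangleq f(s_1..s_l)$, $Y_2:f(t_{k+1}..t_n)\triangleq f(s_{l+1}..s_m)$; extend $\sigma$ by $X\mapsto f(Y_1,Y_2)$. DecC ($f$ commutative, $i\in\{1,2\}$): replace $X:f(t_1,t_2)\triangleq f(s_1,s_2)$ by $Y_1:t_1\triangleq s_i$, $Y_2:t_2\triangleq s_{3-i}$; extend $\sigma$ by $X\mapsto f(Y_1,Y_2)$. DecAC ($f$ AC): as DecA after arbitrary reorderings of the arguments of both sides. *)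

(* Defs.v *)
From HB Require Import structures.
From Stdlib Require Import Permutation Relation_Operators.
From mathcomp Require Import all_boot.
From mathcomp Require Import boolp classical_sets.

Set Implicit Arguments.
Unset Strict Implicit.
Unset Printing Implicit Defensive.

Local Open Scope classical_set_scope.

Inductive theory := ThA | ThC | ThAC.

(* The signature splits into free symbols, with arities, and the symbols of
   Sigma_A, Sigma_C and Sigma_AC, which are all binary. *)
Record signature := Signature {
  fsym : Type;
  arity : fsym -> nat;
  esym : eqType;
  ekind : esym -> theory }.

Definition is_assoc (Sg : signature) (g : esym Sg) : bool :=
  if ekind g is ThC then false else true.

Definition is_comm (Sg : signature) (g : esym Sg) : bool :=
  if ekind g is ThA then false else true.

(* E is empty (esym empty), or only A, or only C, or only AC. *)
Definition single_theory (Sg : signature) : Prop :=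
  exists k : theory, forall g : esym Sg, ekind g = k.

Definition atom := nat.
Definition tvar := nat.
Definition avar := nat.

Inductive gterm (Sg : signature) : Type :=
| GAt of atom
| GFun (f : fsym Sg) of ('I_(arity f) -> gterm Sg)
| GBin of esym Sg & gterm Sg & gterm Sg
| GLam of atom & gterm Sg.
Arguments GAt {Sg}.
Arguments GFun {Sg} f _.
Arguments GBin {Sg}.
Arguments GLam {Sg}.

Record gperm := GPerm {
  gfun :> atom -> atom;
  gfun_bij : bijective gfun;
  gfun_supp : exists l : seq atom, forall a, a \notin l -> gfun a = a }.

Definition gid : gperm.
Proof.
exists id; first by exists id.
by exists [::].
Defined.

Definition swap_fun (a b c : atom) : atom :=
  if c == a then b else if c == b then a else c.

Lemma swap_funK a b : involutive (swap_fun a b).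
Proof.
move=> c; rewrite /swap_fun; case: (c =P a) => [->|/eqP ca].
  by case: (b =P a) => [//|_]; rewrite eqxx.
case: (c =P b) => [->|/eqP cb]; first by rewrite eqxx.
by rewrite (negbTE ca) (negbTE cb).
Qed.

Definition gswap (a b : atom) : gperm.
Proof.
exists (swap_fun a b); first by exists (swap_fun a b); exact: swap_funK.
exists [:: a; b] => c; rewrite !inE negb_or /swap_fun.
by case/andP=> /negbTE-> /negbTE->.
Defined.

Definition gcomp (p q : gperm) : gperm.
Proof.
exists (p \o q); first exact: bij_comp (gfun_bij p) (gfun_bij q).
case: (gfun_supp p) (gfun_supp q) => l hl [k hk].
exists (l ++ k) => c; rewrite mem_cat negb_or => /andP[cl ck] /=.
by rewrite hk // hl.
Defined.

Fixpoint gact (Sg : signature) (p : gperm) (S : gterm Sg) : gterm Sg :=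
  match S with
  | GAt a => GAt (p a)
  | GFun f Ss => GFun f (fun i => gact p (Ss i))
  | GBin g S1 S2 => GBin g (gact p S1) (gact p S2)
  | GLam a S1 => GLam (p a) (gact p S1)
  end.

Fixpoint gfresh (Sg : signature) (a : atom) (S : gterm Sg) : Prop :=
  match S with
  | GAt b => a <> b
  | GFun f Ss => forall i, gfresh a (Ss i)
  | GBin g S1 S2 => gfresh a S1 /\ gfresh a S2
  | GLam b S1 => a = b \/ gfresh a S1
  end.

Inductive eqE (Sg : signature) : gterm Sg -> gterm Sg -> Prop :=
| eqE_refl S : eqE S S
| eqE_sym S T : eqE S T -> eqE T S
| eqE_trans S T U : eqE S T -> eqE T U -> eqE S U
| eqE_fun (f : fsym Sg) (Ss Ts : 'I_(arity f) -> gterm Sg) :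
    (forall i, eqE (Ss i) (Ts i)) -> eqE (GFun f Ss) (GFun f Ts)
| eqE_bin (g : esym Sg) S1 S2 T1 T2 :
    eqE S1 T1 -> eqE S2 T2 -> eqE (GBin g S1 S2) (GBin g T1 T2)
| eqE_lam a S T : eqE S T -> eqE (GLam a S) (GLam a T)
| eqE_alpha a b S T :
    eqE S (gact (gswap a b) T) -> gfresh a T -> eqE (GLam a S) (GLam b T)
| eqE_comm (g : esym Sg) S1 S2 :
    is_comm g -> eqE (GBin g S1 S2) (GBin g S2 S1)
| eqE_assoc (g : esym Sg) S1 S2 S3 :
    is_assoc g ->
    eqE (GBin g (GBin g S1 S2) S3) (GBin g S1 (GBin g S2 S3)).

Definition eclass (Sg : signature) (S : gterm Sg) : set (gterm Sg) :=
  [set T | eqE S T].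

(* [PSwap W1 W2 p] is (W1 W2) o p, and [ASus p A] is p . A *)
Inductive perm : Type :=
| PId
| PSwap of asusp & asusp & perm
with asusp : Type :=
| ASus of perm & avar.

Inductive term (Sg : signature) : Type :=
| TAt of asusp
| TSus of perm & tvar
| TFun (f : fsym Sg) of ('I_(arity f) -> term Sg)
| TBin of esym Sg & term Sg & term Sg
| TLam of asusp & term Sg.
Arguments TAt {Sg}.
Arguments TSus {Sg}.
Arguments TFun {Sg} f _.
Arguments TBin {Sg}.
Arguments TLam {Sg}.

Definition AVar (A : avar) : asusp := ASus PId A.
Definition TVar {Sg : signature} (X : tvar) : term Sg := TSus PId X.

Fixpoint pcomp (p q : perm) : perm :=
  if p is PSwap W1 W2 p' then PSwap W1 W2 (pcomp p' q) else q.

Definition pactW (p : perm) (W : asusp) : asusp :=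
  let: ASus q A := W in ASus (pcomp p q) A.

Fixpoint pact (Sg : signature) (p : perm) (t : term Sg) : term Sg :=
  match t with
  | TAt W => TAt (pactW p W)
  | TSus q X => TSus (pcomp p q) X
  | TFun f ts => TFun f (fun i => pact p (ts i))
  | TBin g t1 t2 => TBin g (pact p t1) (pact p t2)
  | TLam W t1 => TLam (pactW p W) (pact p t1)
  end.

Fixpoint av_in_perm (A : avar) (p : perm) : Prop :=
  if p is PSwap W1 W2 p' then
    [\/ av_in_susp A W1, av_in_susp A W2 | av_in_perm A p']
  else False
with av_in_susp (A : avar) (W : asusp) : Prop :=
  let: ASus p B := W in av_in_perm A p \/ A = B.

Fixpoint av_in (Sg : signature) (A : avar) (t : term Sg) : Prop :=
  match t with
  | TAt W => av_in_susp A W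
  | TSus p _ => av_in_perm A p
  | TFun f ts => exists i, av_in A (ts i)
  | TBin _ t1 t2 => av_in A t1 \/ av_in A t2
  | TLam W t1 => av_in_susp A W \/ av_in A t1
  end.

Fixpoint tv_in (Sg : signature) (X : tvar) (t : term Sg) : Prop :=
  match t with
  | TAt _ => False
  | TSus _ Y => X = Y
  | TFun f ts => exists i, tv_in X (ts i)
  | TBin _ t1 t2 => tv_in X t1 \/ tv_in X t2
  | TLam _ t1 => tv_in X t1
  end.

Record subst (Sg : signature) := Subst {
  stv : tvar -> term Sg;
  sav : avar -> asusp }.

Fixpoint subst_perm (Sg : signature) (sigma : subst Sg) (p : perm) : perm :=
  if p is PSwap W1 W2 p' then
    PSwap (subst_susp sigma W1) (subst_susp sigma W2) (subst_perm sigma p')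
  else PId
with subst_susp (Sg : signature) (sigma : subst Sg) (W : asusp) : asusp :=
  let: ASus p A := W in pactW (subst_perm sigma p) (sav sigma A).

Fixpoint subst_term (Sg : signature) (sigma : subst Sg) (t : term Sg) :
    term Sg :=
  match t with
  | TAt W => TAt (subst_susp sigma W)
  | TSus p X => pact (subst_perm sigma p) (stv sigma X)
  | TFun f ts => TFun f (fun i => subst_term sigma (ts i))
  | TBin g t1 t2 => TBin g (subst_term sigma t1) (subst_term sigma t2)
  | TLam W t1 => TLam (subst_susp sigma W) (subst_term sigma t1)
  end.

Definition subst_id (Sg : signature) : subst Sg := Subst TVar AVar.

(* Postfix composition: first sigma, then tau. *)
Definition subst_comp (Sg : signature) (sigma tau : subst Sg) : subst Sg :=
  Subst (fun X => subst_term tau (stv sigma X))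
        (fun A => subst_susp tau (sav sigma A)).

Definition single_tv (Sg : signature) (X : tvar) (u : term Sg) : subst Sg :=
  Subst (fun Y => if Y == X then u else TVar Y) AVar.

Definition single_av (Sg : signature) (C : avar) (W : asusp) : subst Sg :=
  Subst TVar (fun B => if B == C then W else AVar B).

(* Variables of the domain of sigma count as occurring in sigma. *)
Definition tv_in_subst (Sg : signature) (X : tvar) (sigma : subst Sg) : Prop :=
  stv sigma X <> TVar X \/
  exists Z, stv sigma Z <> TVar Z /\ tv_in X (stv sigma Z).

Definition av_in_subst (Sg : signature) (A : avar) (sigma : subst Sg) : Prop :=
  [\/ sav sigma A <> AVar A,
      exists Z, stv sigma Z <> TVar Z /\ av_in A (stv sigma Z)
    | exists B, sav sigma B <> AVar B /\ av_in_susp A (sav sigma B)].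

(* The pair (W, s) is the constraint W # s. *)
Definition ctx (Sg : signature) := seq (asusp * term Sg).

Definition tv_in_ctx (Sg : signature) (X : tvar) (Gamma : ctx Sg) : Prop :=
  exists c, List.In c Gamma /\ tv_in X c.2.

Definition av_in_ctx (Sg : signature) (A : avar) (Gamma : ctx Sg) : Prop :=
  exists c, List.In c Gamma /\ (av_in_susp A c.1 \/ av_in A c.2).

Definition subst_ctx (Sg : signature) (sigma : subst Sg) (Gamma : ctx Sg) :
    ctx Sg :=
  [seq (subst_susp sigma c.1, subst_term sigma c.2) | c <- Gamma].

Record interp (Sg : signature) := Interp {
  iav : avar -> atom;
  itv : tvar -> gterm Sg }.

Fixpoint eval_perm (Sg : signature) (rho : interp Sg) (p : perm) : gperm :=
  if p is PSwap W1 W2 p' then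
    gcomp (gswap (eval_susp rho W1) (eval_susp rho W2)) (eval_perm rho p')
  else gid
with eval_susp (Sg : signature) (rho : interp Sg) (W : asusp) : atom :=
  let: ASus p A := W in eval_perm rho p (iav rho A).

Fixpoint eval (Sg : signature) (rho : interp Sg) (t : term Sg) : gterm Sg :=
  match t with
  | TAt W => GAt (eval_susp rho W)
  | TSus p X => gact (eval_perm rho p) (itv rho X)
  | TFun f ts => GFun f (fun i => eval rho (ts i))
  | TBin g t1 t2 => GBin g (eval rho t1) (eval rho t2)
  | TLam W t1 => GLam (eval_susp rho W) (eval rho t1)
  end.

Definition ctx_holds (Sg : signature) (rho : interp Sg) (Gamma : ctx Sg) :
    Prop :=
  forall c, List.In c Gamma -> gfresh (eval_susp rho c.1) (eval rho c.2).

Definition entails_eqE (Sg : signature) (Gamma : ctx Sg) (s t : term Sg) :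
    Prop :=
  forall rho, ctx_holds rho Gamma -> eqE (eval rho s) (eval rho t).

Definition entails_atom (Sg : signature) (Gamma : ctx Sg) (W1 W2 : asusp) :
    Prop :=
  forall rho, ctx_holds rho Gamma -> eval_susp rho W1 = eval_susp rho W2.

Definition sem (Sg : signature) (nabla : ctx Sg) (s : term Sg) :
    set (set (gterm Sg)) :=
  [set eclass (eval rho s) | rho in [set rho | ctx_holds rho nabla]].

Definition is_generalization (Sg : signature) (nabla : ctx Sg) (r : term Sg)
    (nabla1 : ctx Sg) (s : term Sg) (nabla2 : ctx Sg) (t : term Sg) : Prop :=
  sem nabla1 s `<=` sem nabla r /\ sem nabla2 t `<=` sem nabla r.

(* [flat g t] lists the arguments of the flattened form of t with respect to
   the associative symbol g, and [flatapp g t ts] is the flattened application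
   g(t, ts), so that g(t) stands for t. *)
Fixpoint flat (Sg : signature) (g : esym Sg) (t : term Sg) : seq (term Sg) :=
  if t is TBin h t1 t2 then
    if h == g then flat g t1 ++ flat g t2 else [:: t]
  else [:: t].

Fixpoint flatapp (Sg : signature) (g : esym Sg) (t : term Sg)
    (ts : seq (term Sg)) : term Sg :=
  if ts is u :: us then TBin g t (flatapp g u us) else t.

(* The argument list of g(t1, t2), flattened when g is A or AC. *)
Definition bin_args (Sg : signature) (g : esym Sg) (t1 t2 : term Sg) :
    seq (term Sg) :=
  if is_assoc g then flat g (TBin g t1 t2) else [:: t1; t2].

(* [Eqn X t s] is X : t =^= s with X a term-variable. *)
Record eqn (Sg : signature) := Eqn {
  elab : tvar;
  elhs : term Sg;
  erhs : term Sg }.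

Inductive store_eqn (Sg : signature) :=
| SEqT of tvar & term Sg & term Sg
| SEqA of avar & asusp & asusp.
Arguments SEqA {Sg}.

(* Along a derivation all labels stay distinct, so the sets P and S are
   represented by sequences taken up to permutation. *)
Record state (Sg : signature) := State {
  prob : seq (eqn Sg);
  store : seq (store_eqn Sg);
  fctx : ctx Sg;
  ssub : subst Sg }.

Definition tv_in_eqn (Sg : signature) (X : tvar) (e : eqn Sg) : Prop :=
  [\/ X = elab e, tv_in X (elhs e) | tv_in X (erhs e)].

Definition av_in_eqn (Sg : signature) (A : avar) (e : eqn Sg) : Prop :=
  av_in A (elhs e) \/ av_in A (erhs e).

Definition tv_in_store_eqn (Sg : signature) (X : tvar) (e : store_eqn Sg) :
    Prop :=
  if e is SEqT Y t s then [\/ X = Y, tv_in X t | tv_in X s] else False.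

Definition av_in_store_eqn (Sg : signature) (A : avar) (e : store_eqn Sg) :
    Prop :=
  match e with
  | SEqT _ t s => av_in A t \/ av_in A s
  | SEqA C W1 W2 => [\/ A = C, av_in_susp A W1 | av_in_susp A W2]
  end.

Definition fresh_tv (Sg : signature) (X : tvar) (st : state Sg) : Prop :=
  [/\ forall e, List.In e (prob st) -> ~ tv_in_eqn X e,
      forall e, List.In e (store st) -> ~ tv_in_store_eqn X e,
      ~ tv_in_ctx X (fctx st)
    & ~ tv_in_subst X (ssub st)].

Definition fresh_av (Sg : signature) (A : avar) (st : state Sg) : Prop :=
  [/\ forall e, List.In e (prob st) -> ~ av_in_eqn A e,
      forall e, List.In e (store st) -> ~ av_in_store_eqn A e,
      ~ av_in_ctx A (fctx st)
    & ~ av_in_subst A (ssub st)].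

Definition dec_applies (Sg : signature) (t s : term Sg) : Prop :=
  (exists f ts ss, t = TFun f ts /\ s = TFun f ss) \/
  (exists g t1 t2 s1 s2, [/\ t = TBin g t1 t2, s = TBin g s1 s2
     & size (bin_args g t1 t2) = size (bin_args g s1 s2)]).

Definition abs_applies (Sg : signature) (t s : term Sg) : Prop :=
  exists W1 t1 W2 s1, t = TLam W1 t1 /\ s = TLam W2 s1.

Definition susAA_applies (Sg : signature) (Gamma : ctx Sg) (t s : term Sg) :
    Prop :=
  exists W1 W2, [/\ t = TAt W1, s = TAt W2 & entails_atom Gamma W1 W2].

Definition susYY_applies (Sg : signature) (Gamma : ctx Sg) (t s : term Sg) :
    Prop :=
  exists p1 p2 Y, [/\ t = TSus p1 Y, s = TSus p2 Y & entails_eqE Gamma t s].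

Definition solAB_applies (Sg : signature) (Gamma : ctx Sg) (t s : term Sg) :
    Prop :=
  exists W1 W2, [/\ t = TAt W1, s = TAt W2 & ~ entails_atom Gamma W1 W2].

(* Applications of A and AC symbols are matched in flattened form, in Dec as well
   as in DecA and DecAC; only binary applications are stored. In Mer, p ranges
   over all permutations with the two entailments that the equivariance
   procedure guarantees. In DecC, i = true keeps the order of s1, s2. *)
Inductive nau_step (Sg : signature) : state Sg -> state Sg -> Prop :=
| Dec_free P P' S Gamma sigma X (f : fsym Sg)
    (ts ss : 'I_(arity f) -> term Sg) (Y : 'I_(arity f) -> tvar) :
    Permutation P (Eqn X (TFun f ts) (TFun f ss) :: P') ->
    injective Y ->
    (forall i, fresh_tv (Y i) (State P S Gamma sigma)) ->
    nau_step (State P S Gamma sigma)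
      (State ([seq Eqn (Y i) (ts i) (ss i) | i <- enum 'I_(arity f)] ++ P')
         S Gamma
         (subst_comp sigma (single_tv X (TFun f (fun i => TVar (Y i))))))
| Dec_bin P P' S Gamma sigma X (g : esym Sg) (t1 t2 s1 s2 : term Sg)
    (Y : tvar) (Ys : seq tvar) :
    Permutation P (Eqn X (TBin g t1 t2) (TBin g s1 s2) :: P') ->
    size (bin_args g t1 t2) = (size Ys).+1 ->
    size (bin_args g s1 s2) = (size Ys).+1 ->
    uniq (Y :: Ys) ->
    (forall Z, Z \in Y :: Ys -> fresh_tv Z (State P S Gamma sigma)) ->
    nau_step (State P S Gamma sigma)
      (State
         ([seq Eqn e.1 e.2.1 e.2.2
          | e <- zip (Y :: Ys) (zip (bin_args g t1 t2) (bin_args g s1 s2))]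
          ++ P')
         S Gamma
         (subst_comp sigma
            (single_tv X (flatapp g (TVar Y) [seq TVar Z | Z <- Ys]))))
| Abs P P' S Gamma sigma X W1 W2 (t s : term Sg) (Y : tvar) (C : avar) :
    Permutation P (Eqn X (TLam W1 t) (TLam W2 s) :: P') ->
    fresh_tv Y (State P S Gamma sigma) ->
    fresh_av C (State P S Gamma sigma) ->
    nau_step (State P S Gamma sigma)
      (State (Eqn Y (pact (PSwap W1 (AVar C) PId) t)
                    (pact (PSwap W2 (AVar C) PId) s) :: P')
         S
         ((AVar C, TLam W1 t) :: (AVar C, TLam W2 s) :: Gamma)
         (subst_comp sigma (single_tv X (TLam (AVar C) (TVar Y)))))
| SusAA P P' S Gamma sigma X W1 W2 :
    Permutation P (Eqn X (TAt W1) (TAt W2) :: P') ->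
    entails_atom Gamma W1 W2 ->
    nau_step (State P S Gamma sigma)
      (State P' S Gamma (subst_comp sigma (single_tv X (TAt W1))))
| SusYY P P' S Gamma sigma X p1 p2 Y :
    Permutation P (Eqn X (TSus p1 Y) (TSus p2 Y) :: P') ->
    entails_eqE Gamma (TSus p1 Y) (TSus p2 Y) ->
    nau_step (State P S Gamma sigma)
      (State P' S Gamma (subst_comp sigma (single_tv X (TSus p1 Y))))
| SolAB P P' S Gamma sigma X W1 W2 (C : avar) :
    Permutation P (Eqn X (TAt W1) (TAt W2) :: P') ->
    ~ entails_atom Gamma W1 W2 ->
    fresh_av C (State P S Gamma sigma) ->
    nau_step (State P S Gamma sigma)
      (State P' (SEqA C W1 W2 :: S)
         ((AVar C, TLam W1 (TLam W2 (TAt (AVar C)))) :: Gamma)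
         (subst_comp sigma (single_tv X (TAt (AVar C)))))
| Sol P P' S Gamma sigma X (t s : term Sg) :
    Permutation P (Eqn X t s :: P') ->
    ~ dec_applies t s ->
    ~ abs_applies t s ->
    ~ susAA_applies Gamma t s ->
    ~ susYY_applies Gamma t s ->
    ~ solAB_applies Gamma t s ->
    nau_step (State P S Gamma sigma) (State P' (SEqT X t s :: S) Gamma sigma)
| Mer_term S S' Gamma sigma Z1 Z2 (t1 s1 t2 s2 : term Sg) (p : perm) :
    Permutation S (SEqT Z1 t1 s1 :: SEqT Z2 t2 s2 :: S') ->
    entails_eqE Gamma (pact p t1) t2 ->
    entails_eqE Gamma (pact p s1) s2 ->
    nau_step (State [::] S Gamma sigma)
      (State [::] (SEqT Z1 t1 s1 :: S')
         (subst_ctx (single_tv Z2 (TSus p Z1)) Gamma)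
         (subst_comp sigma (single_tv Z2 (TSus p Z1))))
| Mer_atom S S' Gamma sigma Z1 Z2 W1 V1 W2 V2 (p : perm) :
    Permutation S (SEqA Z1 W1 V1 :: SEqA Z2 W2 V2 :: S') ->
    entails_eqE Gamma (TAt (pactW p W1)) (TAt W2) ->
    entails_eqE Gamma (TAt (pactW p V1)) (TAt V2) ->
    nau_step (State [::] S Gamma sigma)
      (State [::] (SEqA Z1 W1 V1 :: S')
         (subst_ctx (single_av Sg Z2 (ASus p Z1)) Gamma)
         (subst_comp sigma (single_av Sg Z2 (ASus p Z1))))
| DecA P P' S Gamma sigma X (g : esym Sg) (t1 t2 s1 s2 : term Sg)
    (u1 u2 v1 v2 : term Sg) (us1 us2 vs1 vs2 : seq (term Sg)) (Y1 Y2 : tvar) :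
    ekind g = ThA ->
    Permutation P (Eqn X (TBin g t1 t2) (TBin g s1 s2) :: P') ->
    flat g (TBin g t1 t2) = (u1 :: us1) ++ (u2 :: us2) ->
    flat g (TBin g s1 s2) = (v1 :: vs1) ++ (v2 :: vs2) ->
    Y1 <> Y2 ->
    fresh_tv Y1 (State P S Gamma sigma) ->
    fresh_tv Y2 (State P S Gamma sigma) ->
    nau_step (State P S Gamma sigma)
      (State (Eqn Y1 (flatapp g u1 us1) (flatapp g v1 vs1)
              :: Eqn Y2 (flatapp g u2 us2) (flatapp g v2 vs2) :: P')
         S Gamma
         (subst_comp sigma (single_tv X (TBin g (TVar Y1) (TVar Y2)))))
| DecC P P' S Gamma sigma X (g : esym Sg) (t1 t2 s1 s2 : term Sg)
    (i : bool) (Y1 Y2 : tvar) :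
    ekind g = ThC ->
    Permutation P (Eqn X (TBin g t1 t2) (TBin g s1 s2) :: P') ->
    Y1 <> Y2 ->
    fresh_tv Y1 (State P S Gamma sigma) ->
    fresh_tv Y2 (State P S Gamma sigma) ->
    nau_step (State P S Gamma sigma)
      (State (Eqn Y1 t1 (if i then s1 else s2)
              :: Eqn Y2 t2 (if i then s2 else s1) :: P')
         S Gamma
         (subst_comp sigma (single_tv X (TBin g (TVar Y1) (TVar Y2)))))
| DecAC P P' S Gamma sigma X (g : esym Sg) (t1 t2 s1 s2 : term Sg)
    (u1 u2 v1 v2 : term Sg) (us1 us2 vs1 vs2 : seq (term Sg)) (Y1 Y2 : tvar) :
    ekind g = ThAC ->
    Permutation P (Eqn X (TBin g t1 t2) (TBin g s1 s2) :: P') ->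
    Permutation (flat g (TBin g t1 t2)) ((u1 :: us1) ++ (u2 :: us2)) ->
    Permutation (flat g (TBin g s1 s2)) ((v1 :: vs1) ++ (v2 :: vs2)) ->
    Y1 <> Y2 ->
    fresh_tv Y1 (State P S Gamma sigma) ->
    fresh_tv Y2 (State P S Gamma sigma) ->
    nau_step (State P S Gamma sigma)
      (State (Eqn Y1 (flatapp g u1 us1) (flatapp g v1 vs1)
              :: Eqn Y2 (flatapp g u2 us2) (flatapp g v2 vs2) :: P')
         S Gamma
         (subst_comp sigma (single_tv X (TBin g (TVar Y1) (TVar Y2))))).

Definition nau_plus (Sg : signature) : state Sg -> state Sg -> Prop :=
  clos_trans (state Sg) (@nau_step Sg).

(* Main.v *)
From Stdlib Require Import Permutation Relation_Operators.
From mathcomp Require Import all_boot.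
From mathcomp Require Import boolp classical_sets.
Require Import Defs.

Set Implicit Arguments.
Unset Strict Implicit.
Unset Printing Implicit Defensive.

(** Soundness is proved separately for each of the two sides, selected by a
    boolean. An interpretation realizes a state for that side when it satisfies
    the freshness context and sends every label, in the problem and in the store,
    to the value of the corresponding side of its equation, up to E. Every rule
    carries a realizing interpretation to a realizing one without changing the
    class of the value of X sigma: the rules that introduce variables only need
    the interpretation to be redefined at these fresh variables (an atom away from
    all values in Abs, the value of the chosen side in SolAB), while Mer keeps the
    interpretation, since the entailed equations make Z2 and pi . Z1 agree.
    Starting from rho with X sent to the value of the chosen side gives the
    theorem. *)

(** * Permutation action, freshness and E-equality on ground terms *)

Lemma gact_ext (Sg : signature) (p q : gperm) (S : gterm Sg) :
  p =1 q -> gact p S = gact q S.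
Proof.
move=> pq; elim: S => [a|f Ss IH|g S1 IH1 S2 IH2|a S IH] /=.
- by rewrite pq.
- by congr GFun; apply: funext => i; exact: IH.
- by rewrite IH1 IH2.
- by rewrite pq IH.
Qed.

Lemma gact_id (Sg : signature) (p : gperm) (S : gterm Sg) :
  p =1 id -> gact p S = S.
Proof.
move=> p1; elim: S => [a|f Ss IH|g S1 IH1 S2 IH2|a S IH] /=.
- by rewrite p1.
- by congr GFun; apply: funext => i; exact: IH.
- by rewrite IH1 IH2.
- by rewrite p1 IH.
Qed.

Lemma gact_comp (Sg : signature) (p q : gperm) (S : gterm Sg) :
  gact (gcomp p q) S = gact p (gact q S).
Proof.
elim: S => [a|f Ss IH|g S1 IH1 S2 IH2|a S IH] //=.
- by congr GFun; apply: funext => i; exact: IH.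
- by rewrite IH1 IH2.
- by rewrite IH.
Qed.

Lemma gfun_inj (p : gperm) : injective p.
Proof. exact: bij_inj (gfun_bij p). Qed.

Lemma swap_fun_perm (p : gperm) (a b c : atom) :
  p (swap_fun a b c) = swap_fun (p a) (p b) (p c).
Proof.
by rewrite /swap_fun !(inj_eq (@gfun_inj p)); do 2 case: ifP => // _.
Qed.

Lemma swap_funC (a b c : atom) : swap_fun a b c = swap_fun b a c.
Proof. by rewrite /swap_fun; do 2 case: eqP => // ->. Qed.

Lemma gfresh_gact (Sg : signature) (p : gperm) (a : atom) (S : gterm Sg) :
  gfresh (p a) (gact p S) <-> gfresh a S.
Proof.
elim: S => [b|f Ss IH|g S1 IH1 S2 IH2|b S IH] /=.
- by split=> ab; [move=> e; apply: ab; rewrite e | move/(@gfun_inj p)].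
- by split=> H i; [apply/IH | apply/IH].
- by rewrite IH1 IH2.
- rewrite IH; split=> -[e|H].
  + by left; exact: (@gfun_inj p).
  + by right.
  + by left; rewrite e.
  + by right.
Qed.

(** Induction on the derivation of [eqE]. In the alpha case the swapping is conjugated: p after (a
    b) equals (p(a) p(b)) after p, and freshness is equivariant. *)
Lemma eqE_gact (Sg : signature) (p : gperm) (S T : gterm Sg) :
  eqE S T -> eqE (gact p S) (gact p T).
Proof.
elim=> {S T} /=.
- by move=> S; exact: eqE_refl.
- by move=> S T _; exact: eqE_sym.
- by move=> S T U _ + _; exact: eqE_trans.
- by move=> f Ss Ts _ IH; exact: eqE_fun.
- by move=> g S1 S2 T1 T2 _ + _; exact: eqE_bin.
- by move=> a S T _; exact: eqE_lam.
- move=> a b S T _ IH aT; apply: eqE_alpha; last exact/gfresh_gact.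
  apply: eqE_trans IH _; rewrite -!gact_comp.
  rewrite (@gact_ext _ _ (gcomp (gswap (p a) (p b)) p)); first exact: eqE_refl.
  by move=> c /=; rewrite swap_fun_perm.
- by move=> g S1 S2; exact: eqE_comm.
- by move=> g S1 S2 S3; exact: eqE_assoc.
Qed.

Lemma eqE_gfresh (Sg : signature) (c : atom) (S T : gterm Sg) :
  eqE S T -> gfresh c S <-> gfresh c T.
Proof.
elim=> {S T} //=.
- by move=> S T _ ->.
- by move=> S T U _ -> _ ->.
- by move=> f Ss Ts _ IH; split=> H i; apply/IH.
- by move=> g S1 S2 T1 T2 _ -> _ ->.
- by move=> a S T _ ->.
- move=> a b S T _ -> aT.
  (* Equivariance under (a b). For [c] other than [a] and [b] this is the claim itself; at [a] it
     turns a # T into b # (a b).T. *)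
  have sw d : gfresh (swap_fun a b d) (gact (gswap a b) T) <-> gfresh d T.
    exact: (gfresh_gact (gswap a b)).
  case: (c =P a) => [->|ca]; first by split; [right|left].
  case: (c =P b) => [->|cb].
    split; [by left|right].
    by have := (sw a).2 aT; rewrite /swap_fun eqxx.
  have := sw c; rewrite {1}/swap_fun; case: eqP => // _; case: eqP => // _ E.
  by split=> -[//|/E]; right.
- by move=> g S1 S2 _; split=> -[].
- by move=> g S1 S2 S3 _; split; tauto.
Qed.

(** Atoms are natural numbers and terms are finite, so cofinitely many fresh atoms take the form of
    a bound. The atom for the new variable in Abs is chosen past two such bounds. *)
Lemma gfresh_large (Sg : signature) (S : gterm Sg) :
  exists N, forall a, N <= a -> gfresh a S.
Proof.
elim: S => [b|f Ss IH|g S1 [N1 IH1] S2 [N2 IH2]|b S [N IH]] /=.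
- by exists b.+1 => a ba e; rewrite e ltnn in ba.
- have [F FP] := choice IH.
  by exists (\max_i F i) => a Fa i; apply: FP; apply: leq_trans Fa; exact: leq_bigmax.
- exists (maxn N1 N2) => a; rewrite geq_max => /andP[? ?].
  by split; [exact: IH1|exact: IH2].
- by exists N => a Na; right; exact: IH.
Qed.

(** * Flattened applications of ground terms *)

Fixpoint gflatapp (Sg : signature) (g : esym Sg) (Ss : seq (gterm Sg)) :
    gterm Sg :=
  match Ss with
  | [::] => GAt 0
  | [:: T] => T
  | T :: Ts => GBin g T (gflatapp g Ts)
  end.

(** The left block is reassociated to the right one argument at a time. Both lists are nonempty,
    which avoids the dummy value [GAt 0] of [gflatapp] at the empty list. *)
Lemma gflatapp_cat (Sg : signature) (g : esym Sg) (S T : gterm Sg)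
    (Ss Ts : seq (gterm Sg)) : is_assoc g ->
  eqE (GBin g (gflatapp g (S :: Ss)) (gflatapp g (T :: Ts)))
      (gflatapp g ((S :: Ss) ++ (T :: Ts))).
Proof.
move=> ag; elim: Ss S => [|S' Ss IH] S /=; first exact: eqE_refl.
apply: eqE_trans (eqE_assoc _ _ _ ag) _.
by apply: eqE_bin; [exact: eqE_refl|exact: IH].
Qed.

(** Adjacent transpositions suffice. Swapping the two head arguments is commutativity if nothing
    follows them, and otherwise commutativity between two reassociations. *)
Lemma gflatapp_perm (Sg : signature) (g : esym Sg) (Ss Ts : seq (gterm Sg)) :
  is_assoc g -> is_comm g -> Permutation Ss Ts ->
  eqE (gflatapp g Ss) (gflatapp g Ts).
Proof.
move=> ag cg; elim=> {Ss Ts}.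
- exact: eqE_refl.
(* The last argument stands without [GBin], so equality of lengths is needed to know that the tails
   are both empty or both nonempty. *)
- move=> S Ss Ts /Permutation_length.
  case: Ss Ts => [|S1 Ss] [|T1 Ts] // _ IH; first exact: eqE_refl.
  by apply: eqE_bin; [exact: eqE_refl|].
- move=> S T [|U Us]; first exact: eqE_comm.
  apply: eqE_trans (eqE_sym (eqE_assoc _ _ _ ag)) _.
  apply: eqE_trans (eqE_assoc _ _ _ ag).
  by apply: eqE_bin; [exact: eqE_comm|exact: eqE_refl].
- by move=> ? ? ? _ + _; exact: eqE_trans.
Qed.

(* Evaluation of NLA-terms and substitutions *)
Scheme perm_mut := Induction for perm Sort Prop
  with asusp_mut := Induction for asusp Sort Prop.
Combined Scheme perm_asusp_ind from perm_mut, asusp_mut.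

(** Permutations contain suspensions and conversely, so both claims go through one mutual
    induction. *)
Lemma eval_perm_susp_agree (Sg : signature) (r1 r2 : interp Sg) :
  (forall p, (forall A, av_in_perm A p -> iav r1 A = iav r2 A) ->
     eval_perm r1 p =1 eval_perm r2 p) /\
  (forall W, (forall A, av_in_susp A W -> iav r1 A = iav r2 A) ->
     eval_susp r1 W = eval_susp r2 W).
Proof.
apply: perm_asusp_ind => [//|W1 IH1 W2 IH2 p IH|p IH A] H /=.
  move=> c /=; rewrite IH1 ?IH2 ?IH // => A AW; apply: H;
    by [constructor 1|constructor 2|constructor 3].
by rewrite IH ?H //=; [right|move=> B BW; apply: H; left].
Qed.

Lemma eval_susp_agree (Sg : signature) (r1 r2 : interp Sg) (W : asusp) :
  (forall A, av_in_susp A W -> iav r1 A = iav r2 A) ->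
  eval_susp r1 W = eval_susp r2 W.
Proof. exact: (eval_perm_susp_agree r1 r2).2. Qed.

(** Atom-variables must agree exactly because they act through permutations and binders. For
    term-variables agreement up to E suffices, since [eqE] is a congruence stable under the action;
    Mer provides no more than that. *)
Lemma eval_agree (Sg : signature) (r1 r2 : interp Sg) (t : term Sg) :
  (forall A, av_in A t -> iav r1 A = iav r2 A) ->
  (forall X, tv_in X t -> eqE (itv r1 X) (itv r2 X)) ->
  eqE (eval r1 t) (eval r2 t).
Proof.
elim: t => [W|p X|f ts IH|g t1 IH1 t2 IH2|W t IH] /= Ha Ht.
- by rewrite (eval_susp_agree Ha); exact: eqE_refl.
- rewrite (gact_ext _ ((eval_perm_susp_agree r1 r2).1 p Ha)).
  by apply: eqE_gact; exact: Ht.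
- by apply: eqE_fun => i; apply: IH => V Vt; [apply: Ha|apply: Ht]; exists i.
- by apply: eqE_bin; [apply: IH1|apply: IH2] => V Vt;
    [apply: Ha|apply: Ht|apply: Ha|apply: Ht]; by [left|right].
- rewrite (@eval_susp_agree _ r1 r2) => [|A AW]; last by apply: Ha; left.
  by apply: eqE_lam; apply: IH => V Vt; [apply: Ha; right|apply: Ht].
Qed.

Lemma eval_pcomp (Sg : signature) (rho : interp Sg) (p q : perm) :
  eval_perm rho (pcomp p q) =1 eval_perm rho p \o eval_perm rho q.
Proof.
move=> c /=.
pose P p := eval_perm rho (pcomp p q) c = eval_perm rho p (eval_perm rho q c).
by apply: (@perm_mut P (fun=> True)) => // W1 _ W2 _ p' IH; rewrite /P /= IH.
Qed.

Lemma eval_pactW (Sg : signature) (rho : interp Sg) (p : perm) (W : asusp) :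
  eval_susp rho (pactW p W) = eval_perm rho p (eval_susp rho W).
Proof. by case: W => q A /=; rewrite eval_pcomp. Qed.

Lemma eval_pact (Sg : signature) (rho : interp Sg) (p : perm) (t : term Sg) :
  eval rho (pact p t) = gact (eval_perm rho p) (eval rho t).
Proof.
elim: t => [W|q X|f ts IH|g t1 IH1 t2 IH2|W t IH] /=.
- by rewrite eval_pactW.
- by rewrite -gact_comp; apply: gact_ext => c; rewrite eval_pcomp.
- by congr GFun; apply: funext => i; exact: IH.
- by rewrite IH1 IH2.
- by rewrite eval_pactW IH.
Qed.

(** The pullback of [rho] along [tau], as used in the substitution lemma [eval_subst]. *)
Definition interp_subst (Sg : signature) (tau : subst Sg) (rho : interp Sg) :
    interp Sg :=
  Interp (fun A => eval_susp rho (sav tau A)) (fun X => eval rho (stv tau X)).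

Lemma eval_subst_perm_susp (Sg : signature) (tau : subst Sg) (rho : interp Sg) :
  (forall p, eval_perm rho (subst_perm tau p) =1
     eval_perm (interp_subst tau rho) p) /\
  (forall W, eval_susp rho (subst_susp tau W) =
     eval_susp (interp_subst tau rho) W).
Proof.
apply: perm_asusp_ind => [//|W1 IH1 W2 IH2 p IH c|p IH A] /=.
  by rewrite IH1 IH2 IH.
by rewrite eval_pactW IH.
Qed.

Lemma eval_subst (Sg : signature) (tau : subst Sg) (rho : interp Sg)
    (t : term Sg) :
  eval rho (subst_term tau t) = eval (interp_subst tau rho) t.
Proof.
have [Hp HW] := eval_subst_perm_susp tau rho.
elim: t => [W|q X|f ts IH|g t1 IH1 t2 IH2|W t IH] /=.
- by rewrite HW.
- by rewrite eval_pact; exact: gact_ext.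
- by congr GFun; apply: funext => i; exact: IH.
- by rewrite IH1 IH2.
- by rewrite HW IH.
Qed.

Lemma eval_TVar (Sg : signature) (rho : interp Sg) (X : tvar) :
  eval rho (TVar X) = itv rho X.
Proof. exact: gact_id. Qed.

(** The hypothesis makes the pullback agree with [rho] up to E at every variable. Hence binding a
    variable to a term of equal value is invisible to evaluation, on which every extension of the
    answer substitution at a term-variable rests. *)
Lemma eval_single_tv (Sg : signature) (rho : interp Sg) (X : tvar)
    (u t : term Sg) :
  eqE (itv rho X) (eval rho u) ->
  eqE (eval rho t) (eval rho (subst_term (single_tv X u) t)).
Proof.
move=> Xu; rewrite eval_subst; apply: eval_agree => //= Z _.
case: eqP => [->//|_]; rewrite eval_TVar; exact: eqE_refl.
Qed.

Lemma eval_susp_single_tv (Sg : signature) (rho : interp Sg) (X : tvar)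
    (u : term Sg) (W : asusp) :
  eval_susp rho (subst_susp (single_tv X u) W) = eval_susp rho W.
Proof.
by rewrite (eval_subst_perm_susp _ _).2; exact: eval_susp_agree.
Qed.

Lemma iav_single_av (Sg : signature) (rho : interp Sg) (C A : avar) (V : asusp) :
  iav rho C = eval_susp rho V ->
  iav (interp_subst (single_av Sg C V) rho) A = iav rho A.
Proof. by move=> CV /=; case: eqP => [->|]. Qed.

Lemma eval_single_av (Sg : signature) (rho : interp Sg) (C : avar) (V : asusp)
    (t : term Sg) :
  iav rho C = eval_susp rho V ->
  eqE (eval rho t) (eval rho (subst_term (single_av Sg C V) t)).
Proof.
move=> CV; rewrite eval_subst; apply: eval_agree => [A _|Z _].
  by rewrite iav_single_av.
by rewrite [itv (interp_subst _ _) _]eval_TVar; exact: eqE_refl.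
Qed.

Lemma eval_susp_single_av (Sg : signature) (rho : interp Sg) (C : avar)
    (V W : asusp) :
  iav rho C = eval_susp rho V ->
  eval_susp rho (subst_susp (single_av Sg C V) W) = eval_susp rho W.
Proof.
move=> CV; rewrite (eval_subst_perm_susp _ _).2; apply: eval_susp_agree => A _.
exact: iav_single_av.
Qed.

(** For Mer, which also instantiates the context: freshness survives because it is invariant under
    [eqE]. *)
Lemma ctx_holds_subst (Sg : signature) (tau : subst Sg) (rho : interp Sg)
    (Gamma : ctx Sg) :
  (forall W, eval_susp rho (subst_susp tau W) = eval_susp rho W) ->
  (forall t, eqE (eval rho t) (eval rho (subst_term tau t))) ->
  ctx_holds rho Gamma -> ctx_holds rho (subst_ctx tau Gamma).
Proof.
move=> HW Ht H c; elim: Gamma H => [//|d Gamma IH] H /= [<-|].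
  by rewrite /= HW; apply/(eqE_gfresh _ (Ht d.2)); apply: H; left.
by apply: IH => e eG; apply: H; right.
Qed.

(** * Occurrences of variables, list membership and flattened argument lists *)

Lemma tv_in_pact (Sg : signature) (X : tvar) (p : perm) (t : term Sg) :
  tv_in X (pact p t) <-> tv_in X t.
Proof.
elim: t => [W|q Y|f ts IH|g t1 IH1 t2 IH2|W t IH] //=.
- by split=> -[i /IH]; exists i.
- by rewrite IH1 IH2.
Qed.

(** The substitution erases [X] and brings in only variables of [u]. This carries the occurrence
    condition of [tracked] through an extension of the answer substitution. *)
Lemma tv_in_single_tv (Sg : signature) (X Z : tvar) (u t : term Sg) :
  ~ tv_in Z u -> tv_in Z (subst_term (single_tv X u) t) -> tv_in Z t /\ Z <> X.
Proof.
move=> Zu; elim: t => [W|q Y|f ts IH|g t1 IH1 t2 IH2|W t IH] //=.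
- by rewrite tv_in_pact; case: eqP => // YX ->.
- by move=> [i /IH[? ?]]; split=> //; exists i.
- by move=> [/IH1[? ?]|/IH2[? ?]]; split=> //; [left|right].
Qed.

Lemma In_cat (T : Type) (x : T) (s1 s2 : seq T) :
  List.In x (s1 ++ s2) <-> List.In x s1 \/ List.In x s2.
Proof. by elim: s1 => [|y s1 IH] /=; [tauto|rewrite IH; tauto]. Qed.

Lemma In_map (T U : Type) (f : T -> U) (y : U) (s : seq T) :
  List.In y (map f s) <-> exists2 x, List.In x s & y = f x.
Proof.
elim: s => [|x s IH] /=; first by split=> // -[].
split=> [[<-|/IH[z zs ->]]|[z [<-|zs] yE]].
- by exists x => //; left.
- by exists z => //; right.
- by left.
- by right; apply/IH; exists z.
Qed.

Lemma In_mem (T : eqType) (x : T) (s : seq T) : List.In x s <-> x \in s.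
Proof.
elim: s => //= y s ->; rewrite inE.
by split=> [[->|->]|/orP[/eqP->|]]; rewrite ?eqxx ?orbT //; [left|right].
Qed.

Lemma eq_in_map_In (T U : Type) (f g : T -> U) (s : seq T) :
  (forall x, List.In x s -> f x = g x) -> map f s = map g s.
Proof.
elim: s => //= x s IH fg; rewrite fg ?IH //; last by left.
by move=> y ys; apply: fg; right.
Qed.

Lemma tv_in_flat (Sg : signature) (g : esym Sg) (X : tvar) (t u : term Sg) :
  List.In u (flat g t) -> tv_in X u -> tv_in X t.
Proof.
elim: t => [W|q Y|f ts IH|h t1 IH1 t2 IH2|W t IH] /=; try by case=> // <-.
case: ifP => _ /=; last by case=> // <-.
by move/In_cat=> [ut|ut] Xu; [left; exact: IH1|right; exact: IH2].
Qed.

Lemma tv_in_flatapp (Sg : signature) (g : esym Sg) (X : tvar) (u : term Sg)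
    (us : seq (term Sg)) :
  tv_in X (flatapp g u us) -> exists v, List.In v (u :: us) /\ tv_in X v.
Proof.
elim: us u => [|v us IH] u /=; first by exists u; split=> //; left.
by case=> [Xu|/IH[w [wv Xw]]]; [exists u|exists w]; split=> //; [left|right].
Qed.

Lemma tv_in_bin_args (Sg : signature) (g : esym Sg) (X : tvar)
    (t1 t2 u : term Sg) :
  List.In u (bin_args g t1 t2) -> tv_in X u -> tv_in X (TBin g t1 t2).
Proof.
rewrite /bin_args; case: ifP => _; first exact: tv_in_flat.
by case=> [<-|[<-|//]] /=; [left|right].
Qed.

Lemma eval_flatapp (Sg : signature) (g : esym Sg) (rho : interp Sg)
    (u : term Sg) (us : seq (term Sg)) :
  eval rho (flatapp g u us) = gflatapp g (map (eval rho) (u :: us)).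
Proof. by elim: us u => [|v us IH] u //=; rewrite IH. Qed.

Lemma flat_cons (Sg : signature) (g : esym Sg) (t : term Sg) :
  exists u us, flat g t = u :: us.
Proof.
elim: t => [W|q Y|f ts IH|h t1 [u [us IH1]] t2 IH2|W t IH] /=;
  try by eexists; eexists.
by case: ifP => _; [rewrite IH1|]; eexists; eexists.
Qed.

Lemma eval_flat (Sg : signature) (g : esym Sg) (rho : interp Sg) (t : term Sg) :
  is_assoc g -> eqE (eval rho t) (gflatapp g (map (eval rho) (flat g t))).
Proof.
move=> ag; elim: t => [W|q Y|f ts IH|h t1 IH1 t2 IH2|W t IH] /=;
  try exact: eqE_refl.
case: eqP => [->|_] /=; last exact: eqE_refl.
apply: eqE_trans (eqE_bin _ IH1 IH2) _.
(* Flattened lists are never empty, as [gflatapp_cat] requires. *)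
have [[u1 [us1 ->]] [u2 [us2 ->]]] := (flat_cons g t1, flat_cons g t2).
by rewrite map_cat; exact: gflatapp_cat.
Qed.

Lemma eval_bin_args (Sg : signature) (g : esym Sg) (rho : interp Sg)
    (t1 t2 : term Sg) :
  eqE (eval rho (TBin g t1 t2)) (gflatapp g (map (eval rho) (bin_args g t1 t2))).
Proof.
rewrite /bin_args; case: ifP => [ag|_]; first exact: eval_flat.
exact: eqE_refl.
Qed.

(** * Realizing interpretations and changes at fresh variables *)

Definition side (T : Type) (b : bool) (l r : T) : T := if b then l else r.

Definition eside (Sg : signature) (b : bool) (e : eqn Sg) : term Sg :=
  side b (elhs e) (erhs e).

Definition eqn_realized (Sg : signature) (b : bool) (rho : interp Sg)
    (e : eqn Sg) : Prop :=
  eqE (itv rho (elab e)) (eval rho (eside b e)).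

Definition store_eqn_realized (Sg : signature) (b : bool) (rho : interp Sg)
    (e : store_eqn Sg) : Prop :=
  match e with
  | SEqT X t s => eqE (itv rho X) (eval rho (side b t s))
  | SEqA C W V => iav rho C = eval_susp rho (side b W V)
  end.

Definition realizes (Sg : signature) (b : bool) (rho : interp Sg)
    (st : state Sg) : Prop :=
  [/\ ctx_holds rho (fctx st),
      forall e, List.In e (prob st) -> eqn_realized b rho e
    & forall e, List.In e (store st) -> store_eqn_realized b rho e].

(* Guarantees that X0 is never chosen as a fresh variable; once the problem is
   empty only Mer applies, and no fresh variable is chosen any more. *)
Definition tracked (Sg : signature) (X0 : tvar) (st : state Sg) : Prop :=
  prob st = [::] \/
  (forall e, List.In e (prob st) -> ~ tv_in X0 (elhs e) /\ ~ tv_in X0 (erhs e)) /\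
  (tv_in X0 (stv (ssub st) X0) ->
     (exists2 e, List.In e (prob st) & elab e = X0) \/
     (exists t s, List.In (SEqT X0 t s) (store st))).

(** Phrased as a transfer of invariant and realizers, so that it composes along a derivation. *)
Definition sound_step (Sg : signature) (X0 : tvar) (st st' : state Sg) : Prop :=
  tracked X0 st -> tracked X0 st' /\
  forall b rho, realizes b rho st -> exists2 rho', realizes b rho' st'
    & eqE (eval rho (stv (ssub st) X0)) (eval rho' (stv (ssub st') X0)).

(** Nothing that occurs in the state contains a fresh variable, so values there survive the passage
    from [rho] to [rho'] up to E. The lemmas below record this for each component of the state. *)
Definition agree_off_fresh (Sg : signature) (st : state Sg)
    (rho rho' : interp Sg) : Prop :=
  (forall Z, fresh_tv Z st \/ itv rho Z = itv rho' Z) /\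
  (forall C, fresh_av C st \/ iav rho C = iav rho' C).

Lemma agree_eval (Sg : signature) (st : state Sg) (rho rho' : interp Sg)
    (t : term Sg) :
  agree_off_fresh st rho rho' ->
  (forall Z, fresh_tv Z st -> ~ tv_in Z t) ->
  (forall C, fresh_av C st -> ~ av_in C t) ->
  eqE (eval rho t) (eval rho' t).
Proof.
move=> [agt aga] ft fa; apply: eval_agree => [C Ct|Z Zt].
  by case: (aga C) => // /fa.
by case: (agt Z) => [/ft //|->]; exact: eqE_refl.
Qed.

Lemma agree_eval_susp (Sg : signature) (st : state Sg) (rho rho' : interp Sg)
    (W : asusp) :
  agree_off_fresh st rho rho' -> (forall C, fresh_av C st -> ~ av_in_susp C W) ->
  eval_susp rho W = eval_susp rho' W.
Proof.
move=> [_ aga] fa; apply: eval_susp_agree => C CW.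
by case: (aga C) => // /fa.
Qed.

Lemma agree_eside (Sg : signature) (st : state Sg) (rho rho' : interp Sg)
    (b : bool) (e : eqn Sg) :
  agree_off_fresh st rho rho' -> List.In e (prob st) ->
  eqE (eval rho (eside b e)) (eval rho' (eside b e)).
Proof.
move=> ag ein; apply: (agree_eval ag) => V [fe _ _ _] Ve; apply: (fe e ein);
  rewrite /eside /side in Ve; case: b Ve => Ve.
- by constructor 2.
- by constructor 3.
- by left.
- by right.
Qed.

Lemma agree_ctx (Sg : signature) (st : state Sg) (rho rho' : interp Sg) :
  agree_off_fresh st rho rho' -> ctx_holds rho (fctx st) ->
  ctx_holds rho' (fctx st).
Proof.
move=> ag H c cG.
rewrite -(@agree_eval_susp _ _ rho _ _ ag) => [|C [_ _ fc _] CW]; last first.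
  by apply: fc; exists c; split=> //; left.
apply/(@eqE_gfresh _ _ (eval rho c.2)); last exact: H.
apply: (agree_eval ag) => V [_ _ fc _] Vc; apply: fc;
  by exists c; split=> //; right.
Qed.

Lemma agree_store (Sg : signature) (st : state Sg) (rho rho' : interp Sg)
    (b : bool) (e : store_eqn Sg) :
  agree_off_fresh st rho rho' -> List.In e (store st) ->
  store_eqn_realized b rho e -> store_eqn_realized b rho' e.
Proof.
move=> ag; case: e => [X t s|C W V] ein /=.
  have <- : itv rho X = itv rho' X.
    case: (ag.1 X) => // -[_ fs _ _].
    by case: (fs _ ein); constructor 1.
  move=> H; apply: eqE_trans H _; apply: (agree_eval ag) => Z [_ fs _ _] Ze;
    apply: (fs _ ein); rewrite /side in Ze; case: b Ze => /= Ze;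
    by [constructor 2|constructor 3|left|right].
have <- : iav rho C = iav rho' C.
  by case: (ag.2 C) => // -[_ fs _ _]; case: (fs _ ein); constructor 1.
move=> ->; apply: (agree_eval_susp ag) => A [_ fs _ _] Ae.
apply: (fs _ ein); rewrite /side in Ae; case: b Ae => /= Ae;
  by [constructor 2|constructor 3].
Qed.

Lemma agree_elab (Sg : signature) (st : state Sg) (rho rho' : interp Sg)
    (e : eqn Sg) :
  agree_off_fresh st rho rho' -> List.In e (prob st) ->
  itv rho (elab e) = itv rho' (elab e).
Proof.
move=> ag ein; case: (ag.1 (elab e)) => // -[fe _ _ _].
by case: (fe e ein); constructor 1.
Qed.

(** A fresh [X0] would lie outside the domain of the substitution and hence occur in its own image;
    [tracked] then finds [X0] as a label in the problem or the store, contrary to freshness. *)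
Lemma tracked_not_fresh (Sg : signature) (X0 : tvar) (st : state Sg) :
  tracked X0 st -> prob st <> [::] -> ~ fresh_tv X0 st.
Proof.
move=> [//|[_ lab]] _ [fe fs _ fsub]; apply: fsub; left => sX0.
case: lab => [|[e ein eX0]|[t [s ein]]]; first by rewrite sX0.
- by apply: (fe e ein); constructor 1.
- by apply: (fs _ ein); constructor 1.
Qed.

(** If the substitution moves [X0], all variables of the image occur in the substitution and are not
    fresh. Otherwise the image is [X0] itself, which is not fresh by hypothesis. *)
Lemma agree_ssub (Sg : signature) (X0 : tvar) (st : state Sg)
    (rho rho' : interp Sg) :
  agree_off_fresh st rho rho' -> ~ fresh_tv X0 st ->
  eqE (eval rho (stv (ssub st) X0)) (eval rho' (stv (ssub st) X0)).
Proof.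
move=> ag nf; apply: (agree_eval ag) => V fV Vs.
  case: (pselect (stv (ssub st) X0 = TVar X0)) => [e|ne].
    by move: Vs; rewrite e /= => VX; apply: nf; rewrite -VX.
  by case: fV => _ _ _; apply; right; exists X0.
case: (pselect (stv (ssub st) X0 = TVar X0)) => [e|ne]; first by rewrite e in Vs.
by case: fV => _ _ _; apply; constructor 2; exists X0.
Qed.

(** * Common schemes for steps that solve one equation *)

(** The shape of all rules except Sol and Mer: [X] is bound to [u], while [N], [S'] and [G'] are
    added to the problem, the store and the context. The label [X] is not fresh, so [rho'] still
    gives it the value of the chosen side, which is that of [u]; binding [X] to [u] therefore
    changes no value up to E. *)
Lemma sound_solve (Sg : signature) (X0 X : tvar) (t s u : term Sg)
    (P P' N : seq (eqn Sg)) (S S' : seq (store_eqn Sg)) (G G' : ctx Sg)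
    (sigma : subst Sg) :
  Permutation P (Eqn X t s :: P') ->
  (forall Z, ~ fresh_tv Z (State P S G sigma) -> ~ tv_in Z t -> ~ tv_in Z s ->
     ~ tv_in Z u /\
     forall e, List.In e N -> ~ tv_in Z (elhs e) /\ ~ tv_in Z (erhs e)) ->
  (forall b rho, ctx_holds rho G -> exists rho',
     [/\ agree_off_fresh (State P S G sigma) rho rho',
         eqE (eval rho (side b t s)) (eval rho' u),
         forall e, List.In e N -> eqn_realized b rho' e,
         forall e, List.In e S' -> store_eqn_realized b rho' e
       & ctx_holds rho' G']) ->
  sound_step X0 (State P S G sigma)
    (State (N ++ P') (S' ++ S) (G' ++ G) (subst_comp sigma (single_tv X u))).
Proof.
move=> PP' newv newr tr.
have PE e : List.In e P <-> Eqn X t s = e \/ List.In e P'.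
  split; first exact: (Permutation_in e PP').
  exact: (Permutation_in e (Permutation_sym PP')).
have XP : List.In (Eqn X t s) P by apply/PE; left.
have nf : ~ fresh_tv X0 (State P S G sigma).
  by apply: tracked_not_fresh tr _ => /= P0; rewrite P0 in XP.
case: tr => [/= P0|[/= trP trs]]; first by rewrite P0 in XP.
have [/= X0t X0s] := trP _ XP.
have [X0u X0N] := newv X0 nf X0t X0s.
split.
  right; split=> /= [e /In_cat[/X0N //|eP]|]; first by apply: trP; apply/PE; right.
  (* An occurrence of [X0] in the extended image is an old one with [X0] distinct from [X], so the
     equation labelled [X0] is not the one removed. *)
  case/(tv_in_single_tv X0u) => /trs[[e /PE[<-|eP] eX0]|[t' [s' ein]]] X0X.
  - by case: X0X; rewrite -eX0.
  - by left; exists e => //; apply/In_cat; right.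
  - by right; exists t', s'; apply/In_cat; right.
move=> b rho [/= HG HP HS]; have [rho' [ag tu HN HS' HG']] := newr b rho HG.
have Xu : eqE (itv rho' X) (eval rho' u).
  rewrite -(agree_elab ag XP) /=; apply: eqE_trans (HP _ XP) tu.
exists rho'; last first.
  apply: eqE_trans (agree_ssub ag nf) _; exact: eval_single_tv.
split=> /=.
- by move=> c /In_cat[/HG' //|]; exact: (agree_ctx ag).
- move=> e /In_cat[/HN //|eP].
  have {}eP : List.In e P by apply/PE; right.
  rewrite /eqn_realized -(agree_elab ag eP).
  exact: eqE_trans (HP e eP) (agree_eside b ag eP).
- by move=> e /In_cat[/HS' //|eS]; apply: (agree_store ag eS); exact: HS.
Qed.

(** The sides are evaluated under the old [rho]; in [sound_dec] the labels are fresh, so the updated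
    interpretation gives the sides the same values up to E. *)
Definition upd_labels (Sg : signature) (b : bool) (rho : interp Sg)
    (N : seq (eqn Sg)) : interp Sg :=
  Interp (iav rho)
    (foldr (fun e F Z => if Z == elab e then eval rho (eside b e) else F Z)
       (itv rho) N).

Lemma upd_labels_out (Sg : signature) (b : bool) (rho : interp Sg)
    (N : seq (eqn Sg)) (Z : tvar) :
  Z \notin map (@elab Sg) N -> itv (upd_labels b rho N) Z = itv rho Z.
Proof.
by elim: N => //= e N IH; rewrite inE negb_or => /andP[/negbTE-> /IH].
Qed.

Lemma upd_labels_in (Sg : signature) (b : bool) (rho : interp Sg)
    (N : seq (eqn Sg)) (e : eqn Sg) :
  uniq (map (@elab Sg) N) -> List.In e N ->
  itv (upd_labels b rho N) (elab e) = eval rho (eside b e).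
Proof.
elim: N => //= e' N IH /andP[e'N uN] [->|eN]; first by rewrite eqxx.
case: eqP => [ee'|_]; last exact: IH.
suff : elab e \in map (@elab Sg) N by rewrite ee' (negbTE e'N).
elim: {e'N uN IH} N eN => //= f N IH [->|/IH]; rewrite inE ?eqxx // => ->.
by rewrite orbT.
Qed.

(** For rules that only decompose. Giving each new label the value of its side realizes the new
    equations; the last hypothesis is the algebra of the rule, namely that [u] rebuilt from these
    values is E-equal to the chosen side. *)
Lemma sound_dec (Sg : signature) (X0 X : tvar) (t s u : term Sg)
    (P P' N : seq (eqn Sg)) (S : seq (store_eqn Sg)) (G : ctx Sg)
    (sigma : subst Sg) :
  Permutation P (Eqn X t s :: P') ->
  uniq (map (@elab Sg) N) ->
  (forall Z, Z \in map (@elab Sg) N -> fresh_tv Z (State P S G sigma)) ->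
  (forall e b Z, List.In e N -> tv_in Z (eside b e) -> tv_in Z (side b t s)) ->
  (forall Z, tv_in Z u -> Z \in map (@elab Sg) N) ->
  (forall b rho rho',
     (forall e, List.In e N -> itv rho' (elab e) = eval rho (eside b e)) ->
     eqE (eval rho (side b t s)) (eval rho' u)) ->
  sound_step X0 (State P S G sigma)
    (State (N ++ P') S G (subst_comp sigma (single_tv X u))).
Proof.
move=> PP' uN fN Nts uvar ueq.
have XP : List.In (Eqn X t s) P.
  by apply: Permutation_in (Permutation_sym PP') _; left.
apply: (@sound_solve _ X0 X t s u P P' N S [::] G [::] sigma PP').
  move=> Z nf Zt Zs; split; first by move/uvar/fN.
  by move=> e eN; split; [move/(Nts e true Z eN)|move/(Nts e false Z eN)].
move=> b rho _; exists (upd_labels b rho N).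
have ag : agree_off_fresh (State P S G sigma) rho (upd_labels b rho N).
  split=> [Z|C]; last by right.
  case: (boolP (Z \in map (@elab Sg) N)) => [/fN|/upd_labels_out->]; by [left|right].
split=> // [|e eN].
  by apply: ueq => e eN; exact: upd_labels_in.
(* Variables of the new sides come from [t] or [s], hence are not fresh and keep their values. *)
rewrite /eqn_realized upd_labels_in //; apply: eval_agree => // Z Ze.
case: (ag.1 Z) => [fZ|->]; last exact: eqE_refl.
case: fZ => fe _ _ _; case: (fe _ XP).
by have := Nts e b Z eN Ze; rewrite /side; case: b {ag Ze} => ?;
  [constructor 2|constructor 3].
Qed.

(** Associativity allows any cut point: both terms are E-equal to the flattened application of the
    whole list. *)
Lemma eval_flat_split (Sg : signature) (g : esym Sg) (rho : interp Sg)
    (t u1 u2 : term Sg) (us1 us2 : seq (term Sg)) :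
  is_assoc g -> flat g t = (u1 :: us1) ++ (u2 :: us2) ->
  eqE (eval rho t) (eval rho (TBin g (flatapp g u1 us1) (flatapp g u2 us2))).
Proof.
move=> ag ft; apply: eqE_trans (eval_flat rho t ag) _; apply: eqE_sym.
by rewrite /= !eval_flatapp ft map_cat; exact: gflatapp_cat.
Qed.

Lemma eval_flat_perm_split (Sg : signature) (g : esym Sg) (rho : interp Sg)
    (t u1 u2 : term Sg) (us1 us2 : seq (term Sg)) :
  is_assoc g -> is_comm g ->
  Permutation (flat g t) ((u1 :: us1) ++ (u2 :: us2)) ->
  eqE (eval rho t) (eval rho (TBin g (flatapp g u1 us1) (flatapp g u2 us2))).
Proof.
move=> ag cg ft; apply: eqE_trans (eval_flat rho t ag) _.
have ft' := Permutation_map (eval rho) ft.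
apply: eqE_trans (gflatapp_perm ag cg ft') _; apply: eqE_sym.
rewrite [eval _ _]/= !eval_flatapp.
have := gflatapp_cat (eval rho u1) (eval rho u2) (map (eval rho) us1)
  (map (eval rho) us2) ag.
by rewrite -map_cons -(map_cons _ u2) -map_cat.
Qed.

Lemma tv_in_split (Sg : signature) (g : esym Sg) (Z : tvar)
    (t u1 u2 : term Sg) (us1 us2 : seq (term Sg)) :
  Permutation (flat g t) ((u1 :: us1) ++ (u2 :: us2)) ->
  tv_in Z (flatapp g u1 us1) \/ tv_in Z (flatapp g u2 us2) -> tv_in Z t.
Proof.
move=> ft H.
have [v [vin Zv]] : exists v,
    List.In v ((u1 :: us1) ++ (u2 :: us2)) /\ tv_in Z v.
  case: H => /tv_in_flatapp[v [vin Zv]]; exists v; split=> //; apply/In_cat;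
    by [left|right].
exact: tv_in_flat (Permutation_in v (Permutation_sym ft) vin) Zv.
Qed.

(** Shared by DecA, DecC and DecAC, which differ in how the pairs [a1], [a2] and [b1], [b2] arise
    from [t] and [s]. *)
Lemma sound_dec2 (Sg : signature) (X0 X Y1 Y2 : tvar) (g : esym Sg)
    (t s a1 a2 b1 b2 : term Sg)
    (P P' : seq (eqn Sg)) (S : seq (store_eqn Sg)) (G : ctx Sg)
    (sigma : subst Sg) :
  Permutation P (Eqn X t s :: P') -> Y1 <> Y2 ->
  fresh_tv Y1 (State P S G sigma) -> fresh_tv Y2 (State P S G sigma) ->
  (forall Z, tv_in Z a1 \/ tv_in Z a2 -> tv_in Z t) ->
  (forall Z, tv_in Z b1 \/ tv_in Z b2 -> tv_in Z s) ->
  (forall rho, eqE (eval rho t) (eval rho (TBin g a1 a2))) ->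
  (forall rho, eqE (eval rho s) (eval rho (TBin g b1 b2))) ->
  sound_step X0 (State P S G sigma)
    (State (Eqn Y1 a1 b1 :: Eqn Y2 a2 b2 :: P') S G
       (subst_comp sigma (single_tv X (TBin g (TVar Y1) (TVar Y2))))).
Proof.
move=> PP' Y12 fY1 fY2 ta sb et es.
apply: (@sound_dec _ X0 X t s _ P P' [:: Eqn Y1 a1 b1; Eqn Y2 a2 b2] S G sigma PP').
- by rewrite /= inE andbT; apply/eqP.
- by move=> Z; rewrite !inE => /orP[] /eqP->.
- move=> e b Z [<-|[<-|//]]; rewrite /eside /side /=; case: b => H;
    by [apply: ta; left|apply: ta; right|apply: sb; left|apply: sb; right].
- by move=> Z /= [->|->]; rewrite !inE eqxx ?orbT.
- move=> b rho rho' H.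
  have /= -> := eval_TVar rho' Y1; have /= -> := eval_TVar rho' Y2.
  have /= -> := H _ (or_introl (erefl _)).
  have /= -> := H _ (or_intror (or_introl (erefl _))).
  by rewrite /eside /side; case: b {H}; [exact: et|exact: es].
Qed.

(** * Soundness of the individual rules *)

Lemma sound_Dec_free (Sg : signature) (X0 X : tvar) (f : fsym Sg)
    (ts ss : 'I_(arity f) -> term Sg) (Y : 'I_(arity f) -> tvar)
    (P P' : seq (eqn Sg)) (S : seq (store_eqn Sg)) (G : ctx Sg)
    (sigma : subst Sg) :
  Permutation P (Eqn X (TFun f ts) (TFun f ss) :: P') ->
  injective Y ->
  (forall i, fresh_tv (Y i) (State P S G sigma)) ->
  sound_step X0 (State P S G sigma)
    (State ([seq Eqn (Y i) (ts i) (ss i) | i <- enum 'I_(arity f)] ++ P') S G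
       (subst_comp sigma (single_tv X (TFun f (fun i => TVar (Y i)))))).
Proof.
move=> PP' Yinj fY.
have labE : map (@elab Sg) [seq Eqn (Y i) (ts i) (ss i) | i <- enum 'I_(arity f)]
    = map Y (enum 'I_(arity f)) by rewrite -map_comp.
apply: sound_dec PP' _ _ _ _ _; rewrite ?labE.
- by rewrite map_inj_uniq ?enum_uniq.
- by move=> Z /mapP[i _ ->].
- by move=> e b Z /In_map[i _ ->]; case: b => /= H; exists i.
- by move=> Z [i /= ->]; apply: map_f; rewrite mem_enum.
- move=> b rho rho' H.
  have Hi i : eval rho' (TVar (Y i)) = eval rho (side b (ts i) (ss i)).
    rewrite eval_TVar; apply: (H (Eqn (Y i) (ts i) (ss i))).
    by apply/In_map; exists i => //; apply/In_mem; rewrite mem_enum.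
  have -> : side b (TFun f ts) (TFun f ss) = TFun f (fun i => side b (ts i) (ss i)).
    by case: (b).
  by apply: eqE_fun => i; have /= -> := Hi i; exact: eqE_refl.
Qed.

Lemma sound_Dec_bin (Sg : signature) (X0 X : tvar) (g : esym Sg)
    (t1 t2 s1 s2 : term Sg) (Y : tvar) (Ys : seq tvar)
    (P P' : seq (eqn Sg)) (S : seq (store_eqn Sg)) (G : ctx Sg)
    (sigma : subst Sg) :
  Permutation P (Eqn X (TBin g t1 t2) (TBin g s1 s2) :: P') ->
  size (bin_args g t1 t2) = (size Ys).+1 ->
  size (bin_args g s1 s2) = (size Ys).+1 ->
  uniq (Y :: Ys) ->
  (forall Z, Z \in Y :: Ys -> fresh_tv Z (State P S G sigma)) ->
  sound_step X0 (State P S G sigma)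
    (State
       ([seq Eqn e.1 e.2.1 e.2.2
        | e <- zip (Y :: Ys) (zip (bin_args g t1 t2) (bin_args g s1 s2))]
        ++ P') S G
       (subst_comp sigma
          (single_tv X (flatapp g (TVar Y) [seq TVar Z | Z <- Ys])))).
Proof.
move=> PP'; set ta := bin_args g t1 t2; set sa := bin_args g s1 s2.
move=> szt szs uY fY; set N := [seq _ | _ <- _].
(* Equal lengths keep [zip] from truncating, so the labels and both argument lists are recovered
   from [N] by unzipping. *)
have szz : size (zip ta sa) = size (Y :: Ys) by rewrite size_zip szt szs minnn.
have labE : map (@elab Sg) N = Y :: Ys.
  rewrite -map_comp; change (unzip1 (zip (Y :: Ys) (zip ta sa)) = Y :: Ys).
  by rewrite unzip1_zip ?szz.
have sideE b : map (eside b) N = side b ta sa.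
  have -> : map (eside b) N =
      map (fun p => side b p.1 p.2) (unzip2 (zip (Y :: Ys) (zip ta sa))).
    by rewrite -!map_comp.
  rewrite unzip2_zip ?szz //; case: b.
    by rewrite -[RHS](@unzip1_zip _ _ ta sa) ?szt ?szs.
  by rewrite -[RHS](@unzip2_zip _ _ ta sa) ?szt ?szs.
apply: sound_dec PP' _ _ _ _ _; rewrite ?labE //.
- move=> e b Z eN Ze.
  have : List.In (eside b e) (side b ta sa).
    by rewrite -sideE; apply/In_map; exists e.
  by case: b Ze => /= Ze /tv_in_bin_args /(_ Ze).
- move=> Z /tv_in_flatapp[v [/= vin Zv]].
  have : List.In v (map TVar (Y :: Ys)) by [].
  by case/In_map=> V Vin vE; move: Zv; rewrite vE /= => ->; apply/In_mem.
- move=> b rho rho' H.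
  rewrite eval_flatapp -map_cons -map_comp (eq_map (eval_TVar rho')) -labE.
  rewrite -map_comp (eq_in_map_In H) map_comp sideE.
  by case: (b); exact: eval_bin_args.
Qed.

Lemma sound_Abs (Sg : signature) (X0 X Y : tvar) (C : avar) (W1 W2 : asusp)
    (t s : term Sg) (P P' : seq (eqn Sg)) (S : seq (store_eqn Sg)) (G : ctx Sg)
    (sigma : subst Sg) :
  Permutation P (Eqn X (TLam W1 t) (TLam W2 s) :: P') ->
  fresh_tv Y (State P S G sigma) ->
  fresh_av C (State P S G sigma) ->
  sound_step X0 (State P S G sigma)
    (State (Eqn Y (pact (PSwap W1 (AVar C) PId) t)
                  (pact (PSwap W2 (AVar C) PId) s) :: P') S
       ((AVar C, TLam W1 t) :: (AVar C, TLam W2 s) :: G)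
       (subst_comp sigma (single_tv X (TLam (AVar C) (TVar Y))))).
Proof.
move=> PP' fY fC.
have XP : List.In (Eqn X (TLam W1 t) (TLam W2 s)) P.
  by apply: Permutation_in (Permutation_sym PP') _; left.
apply: (@sound_solve _ X0 X _ _ _ P P' [:: _] S [::] G [:: _; _] sigma PP').
  move=> Z nf /= Zt Zs; split; first by move=> ZY; apply: nf; rewrite ZY.
  by move=> e [<-|//] /=; rewrite !tv_in_pact.
move=> b rho _.
(* The context gains a constraint for each side, so the new atom must be fresh for both bodies
   although only side [b] is being realized. *)
have [[Nt tN] [Ns sN]] := (gfresh_large (eval rho t), gfresh_large (eval rho s)).
pose c := maxn Nt Ns.
have ct : gfresh c (eval rho t) by apply: tN; exact: leq_maxl.
have cs : gfresh c (eval rho s) by apply: sN; exact: leq_maxr.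
pose w := eval_susp rho (side b W1 W2).
pose S0 := eval rho (side b t s).
(* [Y] receives the chosen body with its bound atom [w] renamed to [c]; since c # S0, abstracting
   [c] from it is alpha-equivalent to abstracting [w] from [S0]. *)
pose rho' := Interp (fun A => if A == C then c else iav rho A)
  (fun Z => if Z == Y then gact (gswap w c) S0 else itv rho Z).
have ag : agree_off_fresh (State P S G sigma) rho rho'.
  by split=> V /=; case: eqP => [->|_]; by [left|right].
exists rho'.
have et : eqE (eval rho t) (eval rho' t).
  apply: (agree_eval ag) => V [fe _ _ _] Vt; apply: (fe _ XP);
    by [constructor 2|left; right].
have es : eqE (eval rho s) (eval rho' s).
  apply: (agree_eval ag) => V [fe _ _ _] Vt; apply: (fe _ XP);
    by [constructor 3|right; right].
have eW1 : eval_susp rho W1 = eval_susp rho' W1.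
  by apply: (agree_eval_susp ag) => V [fe _ _ _] Vt; apply: (fe _ XP); left; left.
have eW2 : eval_susp rho W2 = eval_susp rho' W2.
  by apply: (agree_eval_susp ag) => V [fe _ _ _] Vt; apply: (fe _ XP); right; left.
have cC : eval_susp rho' (AVar C) = c by rewrite /= eqxx.
have wS : eqE (eval rho (side b (TLam W1 t) (TLam W2 s))) (GLam w S0).
  by rewrite /w /S0; case: (b); exact: eqE_refl.
have cS0 : gfresh c S0 by rewrite /S0; case: (b).
split=> //.
- apply: eqE_trans wS _.
  rewrite -[eval _ _]/(GLam (eval_susp rho' (AVar C)) (eval rho' (TVar Y))).
  rewrite cC eval_TVar /= eqxx.
  apply: eqE_sym; apply: eqE_alpha => //.
  rewrite (@gact_ext _ (gswap c w) (gswap w c)) => [|d]; first exact: eqE_refl.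
  exact: swap_funC.
- move=> e [<-|//]; rewrite /eqn_realized /eside /= eqxx.
  have -> : side b (pact (PSwap W1 (AVar C) PId) t) (pact (PSwap W2 (AVar C) PId) s)
      = pact (PSwap (side b W1 W2) (AVar C) PId) (side b t s) by case: (b).
  rewrite eval_pact [eval_perm _ _]/= gact_comp (@gact_id _ gid) // -/rho' eqxx.
  have <- : w = eval_susp rho' (side b W1 W2) by rewrite /w; case: (b).
  by apply: eqE_gact; rewrite /S0; case: (b).
- move=> d [<-|[<-|//]]; rewrite /fst /snd cC /=; right.
    exact/(eqE_gfresh _ et).
  exact/(eqE_gfresh _ es).
Qed.

(** The constraint on [C] says exactly that its value is that of [W1] or of [W2], and the chosen
    side supplies one of the two. *)
Lemma sound_SolAB (Sg : signature) (X0 X : tvar) (C : avar) (W1 W2 : asusp)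
    (P P' : seq (eqn Sg)) (S : seq (store_eqn Sg)) (G : ctx Sg)
    (sigma : subst Sg) :
  Permutation P (Eqn X (TAt W1) (TAt W2) :: P') ->
  fresh_av C (State P S G sigma) ->
  sound_step X0 (State P S G sigma)
    (State P' (SEqA C W1 W2 :: S)
       ((AVar C, TLam W1 (TLam W2 (TAt (AVar C)))) :: G)
       (subst_comp sigma (single_tv X (TAt (AVar C))))).
Proof.
move=> PP' fC.
have XP : List.In (Eqn X (TAt W1) (TAt W2)) P.
  by apply: Permutation_in (Permutation_sym PP') _; left.
apply: (@sound_solve _ X0 X _ _ _ P P' [::] S [:: _] G [:: _] sigma PP') => //.
move=> b rho _.
pose w := eval_susp rho (side b W1 W2).
pose rho' := Interp (fun A => if A == C then w else iav rho A) (itv rho).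
have ag : agree_off_fresh (State P S G sigma) rho rho'.
  by split=> V /=; [right|case: eqP => [->|_]; by [left|right]].
have eW1 : eval_susp rho W1 = eval_susp rho' W1.
  by apply: (agree_eval_susp ag) => V [fe _ _ _] Vt; apply: (fe _ XP); left.
have eW2 : eval_susp rho W2 = eval_susp rho' W2.
  by apply: (agree_eval_susp ag) => V [fe _ _ _] Vt; apply: (fe _ XP); right.
have wC : eval_susp rho' (AVar C) = w by rewrite /= eqxx.
exists rho'; split=> //.
- rewrite [eval rho' _]/= eqxx /w; case: (b); exact: eqE_refl.
- by move=> e [<-|//]; rewrite /store_eqn_realized [iav rho' C]wC /w; case: (b).
- move=> d [<-|//]; rewrite /fst /snd wC /= -eW1 -eW2 /w.
  by case: (b); [left|right; left].
Qed.

(** Covers SusAA and SusYY. The binding uses the left term; for the right side the entailment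
    applies, since [rho] satisfies the context. *)
Lemma sound_Sus (Sg : signature) (X0 X : tvar) (t s : term Sg)
    (P P' : seq (eqn Sg)) (S : seq (store_eqn Sg)) (G : ctx Sg)
    (sigma : subst Sg) :
  Permutation P (Eqn X t s :: P') -> entails_eqE G t s ->
  sound_step X0 (State P S G sigma)
    (State P' S G (subst_comp sigma (single_tv X t))).
Proof.
move=> PP' ts; apply: (@sound_solve _ X0 X _ _ _ P P' [::] S [::] G [::] sigma PP') => //.
move=> b rho rG; exists rho; split=> //.
- by split=> V; right.
- by case: b => /=; [exact: eqE_refl|apply: eqE_sym; exact: ts].
Qed.

Lemma sound_Sol (Sg : signature) (X0 X : tvar) (t s : term Sg)
    (P P' : seq (eqn Sg)) (S : seq (store_eqn Sg)) (G : ctx Sg)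
    (sigma : subst Sg) :
  Permutation P (Eqn X t s :: P') ->
  sound_step X0 (State P S G sigma) (State P' (SEqT X t s :: S) G sigma).
Proof.
move=> PP' tr.
have PE e : List.In e P <-> Eqn X t s = e \/ List.In e P'.
  split; first exact: (Permutation_in e PP').
  exact: (Permutation_in e (Permutation_sym PP')).
have XP : List.In (Eqn X t s) P by apply/PE; left.
split.
  case: tr => [/= P0|[/= trP trs]]; first by rewrite P0 in XP.
  right; split=> /= [e eP|/trs[[e /PE[<-|eP] eX0]|[t' [s' ein]]]].
  - by apply: trP; apply/PE; right.
  (* The moved equation may be the one labelled [X0], whence the store alternative in [tracked]. *)
  - by right; exists t, s; left; rewrite -eX0.
  - by left; exists e.
  - by right; exists t', s'; right.
move=> b rho [/= HG HP HS]; exists rho; last exact: eqE_refl.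
split=> //= [e eP|e [<-|/HS //]]; last exact: (HP _ XP).
by apply: HP; apply/PE; right.
Qed.

Lemma sound_Mer_term (Sg : signature) (X0 Z1 Z2 : tvar) (p : perm)
    (t1 s1 t2 s2 : term Sg) (S S' : seq (store_eqn Sg)) (G : ctx Sg)
    (sigma : subst Sg) :
  Permutation S (SEqT Z1 t1 s1 :: SEqT Z2 t2 s2 :: S') ->
  entails_eqE G (pact p t1) t2 -> entails_eqE G (pact p s1) s2 ->
  sound_step X0 (State [::] S G sigma)
    (State [::] (SEqT Z1 t1 s1 :: S')
       (subst_ctx (single_tv Z2 (TSus p Z1)) G)
       (subst_comp sigma (single_tv Z2 (TSus p Z1)))).
Proof.
move=> SS' et es _; split; first by left.
move=> b rho [/= HG _ HS]; have inS e := Permutation_in e (Permutation_sym SS').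
have /= H1 := HS _ (inS _ (or_introl (erefl _))).
have /= H2 := HS _ (inS _ (or_intror (or_introl (erefl _)))).
(* On the chosen side, [Z2] has the value of the second equation, which is that of [p] applied to
   the first, hence to [Z1]. *)
have Z2E : eqE (itv rho Z2) (eval rho (TSus p Z1)).
  apply: eqE_trans H2 _; apply: eqE_sym; rewrite /=.
  apply: eqE_trans (eqE_gact _ H1) _; rewrite -eval_pact.
  by case: (b); [exact: et|exact: es].
exists rho; last exact: eval_single_tv.
split=> //= [|e [<-|eS']].
- apply: ctx_holds_subst HG => [W|t]; first exact: eval_susp_single_tv.
  exact: eval_single_tv.
- exact: H1.
- by apply: HS; apply: inS; right; right.
Qed.

(** If the atoms differed, [b] would be fresh for [GAt a] and thus for [GAt b]. This turns the
    entailments of Mer on atoms into equalities of atoms. *)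
Lemma eqE_GAt (Sg : signature) (a b : atom) : eqE (GAt a : gterm Sg) (GAt b) -> a = b.
Proof.
move/(eqE_gfresh b) => /= H; case: (a =P b) => // ab.
by case: (H.1 _) => // e; apply: ab.
Qed.

Lemma sound_Mer_atom (Sg : signature) (X0 : tvar) (Z1 Z2 : avar) (p : perm)
    (W1 V1 W2 V2 : asusp) (S S' : seq (store_eqn Sg)) (G : ctx Sg)
    (sigma : subst Sg) :
  Permutation S (SEqA Z1 W1 V1 :: SEqA Z2 W2 V2 :: S') ->
  entails_eqE G (TAt (pactW p W1)) (TAt W2) ->
  entails_eqE G (TAt (pactW p V1)) (TAt V2) ->
  sound_step X0 (State [::] S G sigma)
    (State [::] (SEqA Z1 W1 V1 :: S')
       (subst_ctx (single_av Sg Z2 (ASus p Z1)) G)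
       (subst_comp sigma (single_av Sg Z2 (ASus p Z1)))).
Proof.
move=> SS' et es _; split; first by left.
move=> b rho [/= HG _ HS]; have inS e := Permutation_in e (Permutation_sym SS').
have /= H1 := HS _ (inS _ (or_introl (erefl _))).
have /= H2 := HS _ (inS _ (or_intror (or_introl (erefl _)))).
have Z2E : iav rho Z2 = eval_susp rho (ASus p Z1).
  rewrite /= H1 H2 -eval_pactW.
  have [e1 e2] := (eqE_GAt (et _ HG), eqE_GAt (es _ HG)).
  by case: (b).
exists rho; last exact: eval_single_av.
split=> //= [|e [<-|eS']].
- apply: ctx_holds_subst HG => [W|t]; first exact: eval_susp_single_av.
  exact: eval_single_av.
- exact: H1.
- by apply: HS; apply: inS; right; right.
Qed.

(** * From single rules to derivations and generalizations *)

Lemma nau_step_sound (Sg : signature) (X0 : tvar) (st st' : state Sg) :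
  nau_step st st' -> sound_step X0 st st'.
Proof.
case=> {st st'}.
- by move=> *; exact: sound_Dec_free.
- by move=> *; exact: sound_Dec_bin.
- by move=> *; exact: sound_Abs.
- move=> P P' S G sigma X W1 W2 PP' en; apply: sound_Sus PP' _ => rho rG /=.
  by rewrite (en rho rG); exact: eqE_refl.
- by move=> P P' S G sigma X p1 p2 Y PP'; exact: sound_Sus.
- by move=> *; exact: sound_SolAB.
- by move=> *; exact: sound_Sol.
- move=> S S' G sigma Z1 Z2 t1 s1 t2 s2 p SS' et es.
  exact: sound_Mer_term SS' et es.
- move=> S S' G sigma Z1 Z2 W1 V1 W2 V2 p SS' eW eV.
  exact: sound_Mer_atom SS' eW eV.
- move=> P P' S G sigma X g t1 t2 s1 s2 u1 u2 v1 v2 us1 us2 vs1 vs2 Y1 Y2.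
  move=> gA PP' ft fs Y12 fY1 fY2; have ag : is_assoc g by rewrite /is_assoc gA.
  apply: sound_dec2 PP' Y12 fY1 fY2 _ _ _ _ => [Z|Z|rho|rho].
  + by apply: tv_in_split; rewrite ft; exact: Permutation_refl.
  + by apply: tv_in_split; rewrite fs; exact: Permutation_refl.
  + exact: eval_flat_split.
  + exact: eval_flat_split.
- move=> P P' S G sigma X g t1 t2 s1 s2 i Y1 Y2 gC PP' Y12 fY1 fY2.
  have cg : is_comm g by rewrite /is_comm gC.
  apply: sound_dec2 PP' Y12 fY1 fY2 _ _ _ _ => [Z|Z|rho|rho].
  + by [].
  + by case: (i) => /=; tauto.
  + exact: eqE_refl.
  + by case: (i); [exact: eqE_refl|exact: eqE_comm].
- move=> P P' S G sigma X g t1 t2 s1 s2 u1 u2 v1 v2 us1 us2 vs1 vs2 Y1 Y2.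
  move=> gAC PP' ft fs Y12 fY1 fY2.
  have ag : is_assoc g by rewrite /is_assoc gAC.
  have cg : is_comm g by rewrite /is_comm gAC.
  apply: sound_dec2 PP' Y12 fY1 fY2 _ _ _ _ => [Z|Z|rho|rho].
  + exact: tv_in_split.
  + exact: tv_in_split.
  + exact: eval_flat_perm_split.
  + exact: eval_flat_perm_split.
Qed.

Lemma nau_plus_sound (Sg : signature) (X0 : tvar) (st st' : state Sg) :
  nau_plus st st' -> sound_step X0 st st'.
Proof.
elim=> {st st'} [st st'|st1 st2 st3 _ IH1 _ IH2 tr]; first exact: nau_step_sound.
have [tr2 H1] := IH1 tr; have [tr3 H2] := IH2 tr2; split=> // b rho /H1[rho2 r2 e2].
have [rho3 r3 e3] := H2 b rho2 r2.
by exists rho3 => //; exact: eqE_trans e2 e3.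
Qed.

(** [sem] collects classes as sets, so E-equality has to become equality of sets. *)
Lemma eclass_eq (Sg : signature) (S T : gterm Sg) : eqE S T -> eclass S = eclass T.
Proof.
move=> ST; apply/seteqP; split=> U; first exact: eqE_trans (eqE_sym ST).
exact: eqE_trans ST.
Qed.

Theorem mainTheorem2 (Sg : signature) (hE : single_theory Sg)
    (nabla : ctx Sg) (s t : term Sg) (X : tvar)
    (hXnabla : ~ tv_in_ctx X nabla) (hXs : ~ tv_in X s) (hXt : ~ tv_in X t)
    (S : seq (store_eqn Sg)) (Gamma : ctx Sg) (sigma : subst Sg)
    (hder : nau_plus (State [:: Eqn X t s] [::] [::] (subst_id Sg))
                     (State [::] S Gamma sigma)) :
  is_generalization Gamma (stv sigma X) nabla t nabla s.
Proof.
have tr : tracked X (State [:: Eqn X t s] [::] [::] (subst_id Sg)).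
  right; split=> /= [e [<-|//] //|_].
  by left; exists (Eqn X t s) => //; left.
have [_ H] := nau_plus_sound hder tr.
(* The two inclusions are the instances [b = true], for [t], and [b = false], for [s]. *)
suff main b rho : exists2 rho', ctx_holds rho' Gamma
    & eclass (eval rho' (stv sigma X)) = eclass (eval rho (side b t s)).
  by split=> _ [rho _ <-]; [have [rho'] := main true rho|have [rho'] := main false rho];
    exists rho'.
pose rho0 := Interp (iav rho)
  (fun Z => if Z == X then eval rho (side b t s) else itv rho Z).
have [|rho' [/= rG _ _] e] := H b rho0.
  (* Since [X] occurs neither in [t] nor in [s], redefining it leaves the value of the chosen side
     unchanged, so the initial equation is realized. *)
  split=> // e [<-|//]; rewrite /eqn_realized /= eqxx; apply: eval_agree => //= Z Zt.
  case: eqP => [ZX|_]; last exact: eqE_refl.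
  by move: Zt; rewrite ZX /eside; case: (b).
exists rho' => //; apply: eclass_eq; apply: eqE_sym; apply: eqE_trans e.
by have /= -> := eval_TVar rho0 X; rewrite eqxx; exact: eqE_refl.
Qed.
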